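(* The semigroup $A=\langle a,b\mid aab=a\rangle$ (semigroup presentation) is not LWF.
   Context: Maps are written on the right. A semigroup $S$ is LWF (locally wrapped by the class of finite semigroups) if for every finite subset $H$ of $S$ there exist a finite semigroup $D$ and a function $d:D\to S$ such that $H\subseteq Dd$ and for all $x',y'\in D$ with $x'd,\,y'd\in H$ one has $(x'y')d=(x'd)(y'd)$. *)

(* Defs.v *)
From HB Require Import structures.
From mathcomp Require Import all_boot.
From mathcomp Require Import boolp classical_sets cardinality.

Set Implicit Arguments.
Unset Strict Implicit.
Unset Printing Implicit Defensive.

Import Algebra.
Local Open Scope quotient_scope.
Local Open Scope classical_set_scope.
Local Open Scope group_scope.

Definition free_semigroup (X : choiceType) : Type :=
  {w : seq X | w != [::]}.

Section FreeSemigroup.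
Variable X : choiceType.
Local Notation F := (free_semigroup X).

HB.instance Definition _ := SubChoice.on F.

Definition fsg_gen (x : X) : F := exist _ [:: x] isT.

Fact fsg_mul_subproof (u v : F) : val u ++ val v != [::].
Proof. by case: u => [[|x u] hu]. Qed.

Definition fsg_mul (u v : F) : F := exist _ (val u ++ val v) (fsg_mul_subproof u v).

Fact fsg_mulA : associative fsg_mul.
Proof. by move=> u v w; apply: val_inj; rewrite /= catA. Qed.

HB.instance Definition _ := isSemigroup.Build F fsg_mulA.
End FreeSemigroup.

(* The least congruence on S containing r. *)
Inductive gen_cong (S : semigroupType) (r : S -> S -> Prop) : S -> S -> Prop :=
  | gen_cong_base u v : r u v -> gen_cong r u v
  | gen_cong_refl u : gen_cong r u u
  | gen_cong_sym u v : gen_cong r u v -> gen_cong r v u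
  | gen_cong_trans u v w : gen_cong r u v -> gen_cong r v w -> gen_cong r u w
  | gen_cong_mul u u' v v' :
      gen_cong r u v -> gen_cong r u' v' -> gen_cong r (u * u') (v * v').

Section Presentation.
Variables (X : choiceType).
Variable r : free_semigroup X -> free_semigroup X -> Prop.
Local Notation F := (free_semigroup X).

Definition gen_congb : rel F := fun u v => `[< gen_cong r u v >].

Fact gen_congb_refl : reflexive gen_congb.
Proof. by move=> u; apply/asboolP/gen_cong_refl. Qed.

Fact gen_congb_sym : symmetric gen_congb.
Proof.
by move=> u v; apply/asboolP/asboolP => h; apply: gen_cong_sym.
Qed.

Fact gen_congb_trans : transitive gen_congb.
Proof.
by move=> v u w /asboolP huv /asboolP hvw; apply/asboolP/(gen_cong_trans huv).
Qed.

Canonical gen_congb_equiv :=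
  EquivRel gen_congb gen_congb_refl gen_congb_sym gen_congb_trans.

Definition presented : Type := {eq_quot gen_congb}.

HB.instance Definition _ := Choice.on presented.
HB.instance Definition _ := EqQuotient.on presented.

Fact presentedP (u v : F) : u = v %[mod presented] <-> gen_cong r u v.
Proof. by split=> [/eqmodP/asboolP | h] //; apply/eqmodP/asboolP. Qed.

(* Product of classes; independent of representatives by presented_pi_mul. *)
Definition presented_mul (p q : presented) : presented :=
  \pi_presented (repr p * repr q).

Fact presented_pi_mul (u v : F) :
  presented_mul (\pi_presented u) (\pi_presented v) = \pi_presented (u * v).
Proof. by apply/presentedP/gen_cong_mul; apply/presentedP; rewrite reprK. Qed.

Fact presented_mulA : associative presented_mul.
Proof.
elim/quotW=> u; elim/quotW=> v; elim/quotW=> w.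
rewrite (presented_pi_mul v w) (presented_pi_mul u v).
by rewrite (presented_pi_mul u (v * w)) (presented_pi_mul (u * v) w) mulgA.
Qed.

HB.instance Definition _ := isSemigroup.Build presented presented_mulA.
End Presentation.

(* The letters of the presentation < a, b | aab = a > are encoded as
   a := true and b := false; relA is the single pair (aab, a). *)

Local Notation a := (fsg_gen true).
Local Notation b := (fsg_gen false).

Definition relA (u v : free_semigroup bool) : Prop := u = a * a * b /\ v = a.

Definition A : semigroupType := presented relA.

(* The semigroup law of D is only required to be respected by d on pairs of
   elements mapped into H; d need not be a morphism. *)
Definition LWF (S : semigroupType) : Prop :=
  forall H : set S, finite_set H ->
  exists (D : semigroupType) (d : D -> S),
    [/\ finite_set [set: D],
        H `<=` range d
      & forall x y : D, H (d x) -> H (d y) -> d (x * y) = d x * d y].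

(* Main.v *)
From mathcomp Require Import classical_sets cardinality.
From mathcomp Require Import all_boot.
Require Import Defs.

(** The argument works in any semigroup with elements [a] and [b] such that
    [aab = a] and [ab <> abab]; the set that cannot be wrapped is
    [H = {a, b, ab, abab}].

    The relation gives [a . ab = a . abab = a]: left multiplication by [a]
    merges two different elements into [a].  In a finite wrapping [(D, d)],
    left multiplication by a well-chosen preimage [x] of [a] is nevertheless
    injective on the right ideal [T = xD].  Indeed, for a preimage [y] of [b],
    [xxy] is again a preimage of [a], because every product on the way has
    both factors over [H].  If [|xD|] is least among the preimages of [a], the
    inclusions [xxyD <= x(xD) <= xD] are equalities, so multiplication by [x]
    maps [T] onto [T] ([minimal_lmul_inj]).

    Now let [F z] be the set of the [t] in [T] with [tz] over [a].  For [t] in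
    [F z], the element [tzy] lies over [ab] and [xytzy] over [abab].  Hence
    [xt] and [xxyt] both belong to [F (zy)].  Both maps are injective on [T],
    and their images are disjoint as [ab <> abab], so
    [#|F (zy)| >= 2 #|F z|].  Since [F y] contains [xx], a [z] with [F z] as
    large as possible gives a contradiction ([no_finite_wrapping]).

    In [A], the classes of [ab] and [abab] are separated by an action on the
    natural numbers ([letter_act]). *)

Set Implicit Arguments.
Unset Strict Implicit.
Unset Printing Implicit Defensive.

Import Algebra.
Local Open Scope quotient_scope.
Local Open Scope group_scope.

(** Minimality turns [xxyD <= xxD <= xD] into equalities, and a surjection of
    the finite set [xD] onto itself is injective.  The second conclusion lets
    the lemma be applied again to [xxy], which generates the same right
    ideal. *)
Lemma minimal_lmul_inj (D : finType) (mul : D -> D -> D) (X : {pred D})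
    (x y : D) :
    associative mul ->
    (forall u, u \in X -> #|codom (mul x)| <= #|codom (mul u)|) ->
    mul (mul x x) y \in X ->
  {in codom (mul x) &, injective (mul x)} /\
  codom (mul (mul (mul x x) y)) =i codom (mul x).
Proof.
move=> mulA minx xxyX; set x' := mul (mul x x) y.
have sub' : codom (mul x') \subset codom (mul x).
  apply/subsetP=> _ /codomP[t ->]; rewrite /x' -!mulA; exact: codom_f.
have eq' : codom (mul x') =i codom (mul x).
  by apply/subset_cardP => //; apply/eqP; rewrite eqn_leq subset_leq_card ?minx.
split=> //; apply/imset_injP; rewrite eqn_leq leq_imset_card /=.
rewrite -(eq_card eq') subset_leq_card //.
apply/subsetP=> _ /codomP[t ->]; apply/imsetP.
by exists (mul x (mul y t)); rewrite ?codom_f // /x' -!mulA.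
Qed.

(** The doubling argument: if [tz] lies over [a], then [xtzy] and [xxytzy] do
    too, which would make [#|F z|] unbounded on the finite set [D]. *)
Lemma no_finite_wrapping (S : semigroupType) (a b : S)
    (D : finType) (mul : D -> D -> D) (d : D -> S) :
    a * (a * b) = a -> a * b <> (a * b) * (a * b) ->
    associative mul ->
    (exists x, d x = a) -> (exists y, d y = b) ->
  ~ (forall u v, d u \in [:: a; b; a * b; (a * b) * (a * b)] ->
       d v \in [:: a; b; a * b; (a * b) * (a * b)] ->
       d (mul u v) = d u * d v).
Proof.
move=> aab ab_abab mulA [x0 dx0] [y dy] dM.
have aabab : a * ((a * b) * (a * b)) = a by rewrite mulgA aab aab.
pose X := [pred u | d u == a].
have x0X : X x0 by apply/eqP.
have [x /eqP dx minx] := @arg_minnP _ x0 X (fun u => #|codom (mul u)|) x0X.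
have dab u v : d u = a -> d v = b -> d (mul u v) = a * b.
  by move=> du dv; rewrite dM ?du ?dv // !inE eqxx ?orbT.
have daab u v : d u = a -> d v = a * b -> d (mul u v) = a.
  by move=> du dv; rewrite dM ?du ?dv // !inE eqxx ?orbT.
have dabab u v : d u = a * b -> d v = a * b ->
    d (mul u v) = (a * b) * (a * b).
  by move=> du dv; rewrite dM ?du ?dv // !inE eqxx ?orbT.
have daabab u v : d u = a -> d v = (a * b) * (a * b) -> d (mul u v) = a.
  by move=> du dv; rewrite dM ?du ?dv // !inE eqxx ?orbT.
have xxyX u : d u = a -> d (mul (mul u u) y) = a.
  by move=> du; rewrite -mulA; apply: daab => //; apply: dab.
set x' := mul (mul x x) y.
have dx' : d x' = a by apply: xxyX.
have [injx eqT] : {in codom (mul x) &, injective (mul x)} /\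
    codom (mul x') =i codom (mul x).
  by apply: (@minimal_lmul_inj _ _ X) => //; rewrite inE xxyX.
have [injx' _] : {in codom (mul x') &, injective (mul x')} /\
    codom (mul (mul (mul x' x') y)) =i codom (mul x').
  apply: (@minimal_lmul_inj _ _ X) => //; last by rewrite inE xxyX.
  by move=> u uX; rewrite (eq_card eqT) minx.
pose F z := [set t in codom (mul x) | d (mul t z) == a].
have [z _ maxz] := @arg_maxnP _ y xpredT (fun z => #|F z|) isT.
have Fz_gt0 : 0 < #|F z|.
  apply: leq_trans (maxz y isT); apply/card_gt0P; exists (mul x x).
  by rewrite inE codom_f /= xxyX.
pose G := mul x @: F z; pose G' := mul x' @: F z.
have dzy t : t \in F z -> d (mul t (mul z y)) = a * b.
  by rewrite inE mulA => /andP[_ /eqP dtz]; apply: dab.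
have dxyzy t : t \in F z ->
    d (mul (mul x y) (mul t (mul z y))) = (a * b) * (a * b).
  by move=> tF; apply: dabab; [apply: dab | apply: dzy].
have cG : #|G| = #|F z|.
  apply: card_in_imset => s t; rewrite !inE => /andP[sT _] /andP[tT _].
  exact: injx.
have cG' : #|G'| = #|F z|.
  apply: card_in_imset => s t; rewrite !inE => /andP[sT _] /andP[tT _].
  by apply: injx'; rewrite eqT.
have sub : G :|: G' \subset F (mul z y).
  rewrite subUset; apply/andP; split; apply/subsetP=> _ /imsetP[t tF ->];
    rewrite inE.
    by rewrite codom_f -mulA; apply/eqP/daab => //; apply: dzy.
  rewrite -eqT codom_f; apply/eqP.
  (* Only this bracketing has the factors of each product over H. *)
  have -> : mul (mul x' t) (mul z y) = mul x (mul (mul x y) (mul t (mul z y))).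
    by rewrite /x' !mulA.
  by apply: daabab => //; apply: dxyzy.
have disj : [disjoint G & G'].
  apply/pred0P=> w; apply/negP => /andP[/imsetP[s sF ->] /imsetP[t tF]].
  rewrite /x' -!mulA => /injx xs_xxyt; apply: ab_abab.
  have s_xyt : s = mul x (mul y t).
    by apply: xs_xxyt; [move: sF; rewrite inE => /andP[] | apply: codom_f].
  by rewrite -{1}(dzy s sF) -(dxyzy t tF) s_xyt !mulA.
have cardU : #|G :|: G'| = #|F z| + #|F z|.
  by apply/eqP; rewrite -{1}cG -cG' (leq_card_setU G G').
have := leq_trans (subset_leq_card sub) (maxz _ isT).
by rewrite cardU -{3}[#|F z|]addn0 leq_add2l leqNgt Fz_gt0.
Qed.

Lemma aab_not_LWF (S : semigroupType) (a b : S) :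
  a * (a * b) = a -> a * b <> (a * b) * (a * b) -> ~ LWF S.
Proof.
move=> aab ab_abab lwf.
set h := [:: a; b; a * b; (a * b) * (a * b)].
have [D [d [/finite_seqP[s sD] hd dM]]] := lwf [set` h]%classic (finite_seq h).
have inD u : u \in s by have : [set: D]%classic u by []; rewrite sD.
(* D is only finite as a set; seq_sub s is a copy of it that is a finType. *)
pose mul (u v : seq_sub s) := SeqSub (inD (ssval u * ssval v)).
have := @no_finite_wrapping S a b (seq_sub s) mul (fun u => d (ssval u))
  aab ab_abab.
apply=> [||| u v hu hv]; last exact: dM.
- by move=> u v w; apply: val_inj; rewrite /= mulgA.
- have [|x _ dx] := hd a; first by rewrite /= !inE eqxx.
  by exists (SeqSub (inD x)).
- have [|y _ dy] := hd b; first by rewrite /= !inE eqxx orbT.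
  by exists (SeqSub (inD y)).
Qed.

(** An action of [A] on the right, with [true] for [a] and [false] for [b].  The
    relation [aab = a] only asks that [b] undo [a] on the image of [aa], that
    is from 4 on; the values of [b] below 4 are free, and those at 2 and 3 are
    chosen so that [ab] sends 0 to 1 and [abab] sends 0 to 0.  The set acted on
    has to be infinite: on a finite one, [a] permutes its image and [b] inverts
    it there, so [ab] and [abab] act in the same way. *)
Definition letter_act (n : nat) (c : bool) : nat :=
  if c then n.+2 else if n < 4 then 3 - n else n - 2.

Lemma gen_cong_act (u v : free_semigroup bool) :
  gen_cong relA u v ->
  forall n, foldl letter_act n (val u) = foldl letter_act n (val v).
Proof.
elim=> {u v} [u v [-> ->] n | // | u v _ IH n | u v w _ IH1 _ IH2 n
             | u u' v v' _ IH1 _ IH2 n] /=.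
- by rewrite /letter_act !subSS subn0.
- by rewrite IH.
- by rewrite IH1 IH2.
- by rewrite !foldl_cat IH1 IH2.
Qed.

Theorem proposition12 : ~ LWF A.
Proof.
pose a := fsg_gen true; pose b := fsg_gen false.
have piM u v : (\pi_(presented relA) u : A) * \pi_(presented relA) v
    = \pi_(presented relA) (u * v) by apply: presented_pi_mul.
apply: (@aab_not_LWF A (\pi_(presented relA) a) (\pi_(presented relA) b));
  rewrite (piM a b).
- rewrite (piM a (a * b)); apply/presentedP/gen_cong_base.
  by rewrite mulgA; split.
- by rewrite (piM (a * b) (a * b)) => /presentedP/gen_cong_act/(_ 0).
Qed.
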